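(* For every positive integer $n$ there exists a constant $c(n)>0$, depending only on $n$, such that the following holds. Let $(R,\mathfrak{m})$ be a finite chain ring whose residue field $R/\mathfrak{m}$ has cardinality $q$ and such that $R$ has cardinality $q^r$. If $A,B,C\subset \mathrm{M}_n(R)$, then $$ |A+BC| \geq c(n)\min \left( q^{rn^{2}}, \frac{|A||B||C|}{q^{2rn^2-\frac{n+1}{2}}} \right). $$
   Context: A finite chain ring is a finite commutative ring with $1$ which is local and whose maximal ideal $\mathfrak{m}$ is principal (equivalently, a finite commutative ring with $1$ that is a local principal ideal ring). $\mathrm{M}_n(R)$ is the ring of $n\times n$ matrices over $R$. For $A,B,C\subset \mathrm{M}_n(R)$, $A+BC=\{a+bc: a\in A,\, b\in B,\, c\in C\}$. *)

(* Defs.v *)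
From HB Require Import structures.
From mathcomp Require Import all_boot all_order all_algebra.
From mathcomp Require Import generic_quotient ring_quotient.
Set Implicit Arguments.
Unset Strict Implicit.
Unset Printing Implicit Defensive.
Import GRing.Theory.
Local Open Scope ring_scope.
Local Open Scope quotient_scope.

Definition residue_ring (R : finComNzRingType) (m : idealr R) : Type :=
  {ideal_quot m}.
HB.instance Definition _ (R : finComNzRingType) (m : idealr R) :=
  GRing.ComNzRing.copy (residue_ring m) {ideal_quot m}.
(* A quotient of a finite ring is finite: transport along representatives. *)
HB.instance Definition _ (R : finComNzRingType) (m : idealr R) :=
  isCountable.Build (residue_ring m)
    (pcan_pickleK (can_pcan (@reprK R {ideal_quot m}))).
HB.instance Definition _ (R : finComNzRingType) (m : idealr R) :=
  isFinite.Build (residue_ring m)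
    (pcan_enumP (can_pcan (@reprK R {ideal_quot m}))).

(* [idealr R] is the library's type of decidable proper ideals; decidability is
   no restriction since [R] is finite. *)
Definition maximal_ideal (R : finComNzRingType) (m : idealr R) : Prop :=
  forall J : idealr R, {subset m <= J} -> J =i m.

Definition local_ring (R : finComNzRingType) (m : idealr R) : Prop :=
  maximal_ideal m /\ (forall J : idealr R, maximal_ideal J -> J =i m).

Definition principal_ideal (R : finComNzRingType) (m : idealr R) : Prop :=
  exists x : R, forall y : R, y \in m <-> exists z : R, y = x * z.

Definition finite_chain_ring (R : finComNzRingType) (m : idealr R) : Prop :=
  local_ring m /\ principal_ideal m.

Definition addmul_set (R : finComNzRingType) (n : nat)
    (A B C : {set 'M[R]_n}) : {set 'M[R]_n} :=
  [set a + d | a in A, d in [set b *m c | b in B, c in C]].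

(* Main.v *)
Require Import Defs.
From mathcomp Require Import all_boot all_order all_algebra.
From mathcomp Require Import generic_quotient ring_quotient.
From mathcomp Require Import reals exp.
From HB Require Import structures.
From mathcomp Require Import fingroup algC classfun character.
From mathcomp Require Import ring lra zify.
Import Order.TTheory.
Import GRing.Theory Num.Theory.
Local Open Scope ring_scope.

(** The proof is Fourier analysis on the additive group G of n x n matrices
    over R, with N = |G|. Put S = A + BC and P = |A||B||C|. Every triple
    (a, b, c) solves a + bc = s for exactly one s in S, so expanding the
    condition a + bc = s in characters of G gives
<<
      N P = sum over chi of A^(chi) * M(chi) * conj S^(chi),
      where M(chi) = sum over b in B, c in C of chi(bc).
>>
    The trivial character contributes P |S|. If |S| <= N / 2, the nontrivial
    characters must account for at least N P / 2.

    A nontrivial chi has small M(chi): Cauchy-Schwarz in b and orthogonality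
    leave only the pairs (c, c') for which c - c' lies in
    J = {v | chi(uv) = 1 for all u}, so |M(chi)|^2 <= |B||C| N |J|
    ([bilinear_char_sum_le]). This J is a proper left ideal of the matrix ring.
    A left ideal consists of the matrices all of whose rows lie in a fixed
    submodule of R^n. A proper submodule has index at least q, and the n rows
    are independent, so |J| <= N / q^n ([card_proper_left_ideal_le]); this is
    where the locality of R enters. Cauchy-Schwarz over chi together with
    Parseval then yields P q^n <= 4 N^2 |S| ([card_addmul_set]).

    The resulting exponent 2rn^2 - n is at most 2rn^2 - (n+1)/2 because n >= 1,
    and c(n) = 1/4 works for every n. *)

(** * Cauchy-Schwarz for finite sums *)

(** Lagrange's identity: the defect for the moduli a = |f|, b = |g| is half the
    sum of the squares (a_i b_j - a_j b_i)^2. *)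
Lemma cauchy_schwarz_sum (F : numClosedFieldType) (I : finType) (P : pred I)
    (f g : I -> F) :
  `|\sum_(i | P i) f i * g i| ^+ 2
    <= (\sum_(i | P i) `|f i| ^+ 2) * (\sum_(i | P i) `|g i| ^+ 2).
Proof.
pose a i := `|f i|; pose b i := `|g i|.
have Z0 : 0 <= \sum_(i | P i) a i * b i.
  by apply: sumr_ge0 => i _; rewrite mulr_ge0 ?normr_ge0.
have le1 : `|\sum_(i | P i) f i * g i| <= \sum_(i | P i) a i * b i.
  apply: le_trans (ler_norm_sum _ _ _) _.
  by apply: ler_sum => i _; rewrite normrM.
apply: (@le_trans _ _ ((\sum_(i | P i) a i * b i) ^+ 2)).
  by rewrite ler_sqr ?nnegrE ?normr_ge0.
have : 0 <= \sum_(i | P i) \sum_(j | P j) (a i * b j - a j * b i) ^+ 2.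
  apply: sumr_ge0 => i _; apply: sumr_ge0 => j _.
  by rewrite real_exprn_even_ge0 // rpredB // rpredM // normr_real.
have -> : \sum_(i | P i) \sum_(j | P j) (a i * b j - a j * b i) ^+ 2 =
   (\sum_(i | P i) a i ^+ 2) * (\sum_(i | P i) b i ^+ 2) *+ 2
   - (\sum_(i | P i) a i * b i) ^+ 2 *+ 2.
  have E i j : (a i * b j - a j * b i) ^+ 2 =
    a i ^+ 2 * b j ^+ 2 + b i ^+ 2 * a j ^+ 2 - (a i * b i) * (a j * b j) *+ 2.
    by ring.
  under eq_bigr => i _ do under eq_bigr => j _ do rewrite E.
  under eq_bigr => i _ do
    rewrite big_split /= sumrN big_split /= sumrMnl -!mulr_sumr.
  by rewrite big_split /= sumrN big_split /= sumrMnl -!mulr_suml; ring.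
by rewrite subr_ge0 ler_pMn2r.
Qed.

(** * Additive characters and bilinear character sums *)

Definition additive_char (G : finZmodType) (phi : G -> algC) : Prop :=
  {morph phi : x y / x + y >-> x * y} /\ forall x, `|phi x| = 1.

Lemma additive_char0 (G : finZmodType) (phi : G -> algC) :
  additive_char G phi -> phi 0 = 1.
Proof.
case=> phiD phi1; have n0 : phi 0 != 0 by rewrite -normr_eq0 phi1 oner_eq0.
by apply: (mulfI n0); rewrite -phiD addr0 mulr1.
Qed.

Lemma additive_charN (G : finZmodType) (phi : G -> algC) :
  additive_char G phi -> {morph phi : x / - x >-> x^*}.
Proof.
move=> phi_char x; have [phiD phi1] := phi_char.
have n0 : phi x != 0 by rewrite -normr_eq0 phi1 oner_eq0.
apply: (mulfI n0); rewrite -phiD subrr (additive_char0 G _ phi_char).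
by rewrite -normCK phi1 expr1n.
Qed.

(** Translating the summation variable by y multiplies the sum by phi y, so the
    sum vanishes as soon as some phi y differs from 1. *)
Lemma sum_multiplicative (G : finZmodType) (phi : G -> algC) :
  {morph phi : x y / x + y >-> x * y} ->
  \sum_x phi x = #|G|%:R *+ [forall x, phi x == 1].
Proof.
move=> phiD; case: forallP => [phi1|].
  by under eq_bigr => x _ do rewrite (eqP (phi1 x)); rewrite sumr_const.
move/forallP; rewrite negb_forall => /existsP[y phiy].
have : phi y * \sum_x phi x = \sum_x phi x.
  rewrite mulr_sumr [RHS](reindex_inj (addrI y)) /=.
  by apply: eq_bigr => x _; rewrite phiD.
move/eqP; rewrite -subr_eq0 -{2}[\sum_x _]mul1r -mulrBl mulf_eq0 subr_eq0.
by rewrite (negbTE phiy) => /eqP.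
Qed.

(** For the multiplication of a ring this is the largest left ideal contained
    in the kernel of phi. *)
Definition char_annihilator (U V G : finZmodType) (mul : U -> V -> G)
    (phi : G -> algC) : {set V} :=
  [set v | [forall u, phi (mul u v) == 1]].

(** After Cauchy-Schwarz in b, extending the outer sum from B to all of U makes
    the sum over b of phi (b (c - d)) complete: it is |U| when c - d lies in the
    annihilator and 0 otherwise. For each c in C at most as many d survive as
    the annihilator has elements. *)
Lemma bilinear_char_sum_le (U V G : finZmodType) (mul : U -> V -> G)
    (mulDl : forall v, {morph mul^~ v : x y / x + y})
    (mulDr : forall u, {morph mul u : x y / x + y})
    (phi : G -> algC) (B : {set U}) (C : {set V}) :
  additive_char G phi ->
  `|\sum_(b in B) \sum_(c in C) phi (mul b c)| ^+ 2
    <= (#|B| * #|C| * (#|U| * #|char_annihilator U V G mul phi|))%:R.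
Proof.
move=> phi_char; have phiD := phi_char.1.
set J := char_annihilator _ _ _ _ _.
pose T b := \sum_(c in C) phi (mul b c).
have mul0r u : mul u 0 = 0 by apply: (addrI (mul u 0)); rewrite -mulDr !addr0.
have mulNr u v : mul u (- v) = - mul u v.
  by apply: (addrI (mul u v)); rewrite -mulDr !subrr.
have sumT : \sum_b `|T b| ^+ 2 <= (#|C| * (#|U| * #|J|))%:R.
  have -> : \sum_b `|T b| ^+ 2 =
      \sum_(c in C) \sum_(d in C) #|U|%:R *+ (c - d \in J).
    transitivity (\sum_b \sum_(c in C) \sum_(d in C) phi (mul b (c - d))).
      apply: eq_bigr => b _; rewrite normCK /T rmorph_sum mulr_suml.
      apply: eq_bigr => c _; rewrite mulr_sumr; apply: eq_bigr => d _.
      by rewrite mulDr phiD mulNr (additive_charN G _ phi_char).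
    rewrite exchange_big; apply: eq_bigr => c _ /=.
    rewrite exchange_big; apply: eq_bigr => d _ /=.
    rewrite (sum_multiplicative U (fun b => phi (mul b (c - d)))) ?inE //.
    by move=> x y /=; rewrite mulDl phiD.
  rewrite natrM mulr_natl -[leRHS]sumr_const; apply: ler_sum => c _.
  under eq_bigr do rewrite -mulr_natr.
  apply: (@le_trans _ _ (\sum_d #|U|%:R * (c - d \in J)%:R)).
    rewrite [leRHS](bigID (mem C)) /= lerDl; apply: sumr_ge0 => d _.
    by rewrite -natrM ler0n.
  rewrite -mulr_sumr natrM ler_wpM2l ?ler0n //.
  rewrite (reindex_inj (inj_comp (addrI c) (@oppr_inj V))) /=.
  under eq_bigr do rewrite opprD opprK addNKr.
  by rewrite -natr_sum ler_nat -big_mkcond /= sum1_card.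
rewrite -/(T _).
have := cauchy_schwarz_sum _ _ (mem B) (fun=> 1) T.
under eq_bigr do rewrite mul1r.
move/le_trans; apply.
under eq_bigr do rewrite normr1 expr1n.
rewrite sumr_const -mulnA natrM ler_wpM2l ?ler0n //.
apply: le_trans sumT; rewrite [leRHS](bigID (mem B)) /= lerDl.
by apply: sumr_ge0 => b _; rewrite exprn_ge0 ?normr_ge0.
Qed.

(** * Fourier analysis on a finite abelian group *)

Section Fourier.
Variable G : finZmodType.
Local Notation chi i := ('chi[[set: G]]_i : G -> algC).

Lemma irr_additive_char i : additive_char G (chi i).
Proof.
have /char_abelianP/(_ i) lin_i := FinRing.zmod_abelian [set: G]%G.
split=> [x y|x]; first by apply: (lin_charM lin_i); rewrite inE.
by apply: (normC_lin_char lin_i); rewrite inE.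
Qed.

Lemma irr_nontrivial i : i != 0 -> exists x, chi i x != 1.
Proof.
move=> i0; apply/existsP; rewrite -negb_forall.
apply: contra i0 => /forallP chi1.
apply/eqP/irr_inj; rewrite irr0; apply/cfunP => x.
by rewrite cfun1E inE; apply/eqP/chi1.
Qed.

Lemma sum_irr_conj x y : \sum_i chi i x * (chi i y)^* = #|G|%:R *+ (x == y).
Proof.
have cG := FinRing.zmod_abelian [set: G].
rewrite second_orthogonality_relation ?inE //.
have -> : 'C_[set: G][x]%g = [set: G].
  by apply/setIidPl; rewrite sub_cent1 (subsetP cG) ?inE.
rewrite cardsT; congr (_ *+ nat_of_bool _).
apply/imsetP/eqP => [[z _ ->]|->]; last by exists 0; rewrite ?inE ?conjg1.
by rewrite conjgE /mulg /= /invg /= addrCA addNr addr0.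
Qed.

Definition fourier (A : {set G}) i : algC := \sum_(a in A) chi i a.

Lemma parseval A : \sum_i `|fourier A i| ^+ 2 = (#|G| * #|A|)%:R.
Proof.
under eq_bigr => i _ do rewrite normCK /fourier rmorph_sum mulr_suml.
under eq_bigr => i _ do under eq_bigr => a _ do rewrite mulr_sumr.
rewrite exchange_big /= natrM mulr_natr -sumr_const; apply: eq_bigr => a aA.
rewrite exchange_big /=; under eq_bigr do rewrite sum_irr_conj.
rewrite (bigD1 a aA) /= eqxx big1 ?addr0 // => b /andP[_].
by rewrite eq_sym => /negPf->.
Qed.

Lemma fourier0 A : fourier A 0 = #|A|%:R.
Proof.
by rewrite -sum1_card natr_sum; apply: eq_bigr => a _; rewrite irr0 cfun1E inE.
Qed.

End Fourier.

(** * Expansion from a spectral gap *)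

(** The factor k is the gap: annihilators of nontrivial characters have density
    at most 1/k. Either S fills more than half of G, or the nontrivial
    characters carry at least half of the solutions of a + bc = s, and then
    Cauchy-Schwarz with the bound on each bilinear sum makes S large. *)
Lemma add_mul_expansion (U V G : finZmodType) (mul : U -> V -> G)
    (mulDl : forall v, {morph mul^~ v : x y / x + y})
    (mulDr : forall u, {morph mul u : x y / x + y}) (k : nat)
    (annihilator_le : forall phi : G -> algC,
       additive_char G phi -> (exists x, phi x != 1) ->
       (#|char_annihilator U V G mul phi| * k <= #|V|)%N)
    (A S : {set G}) (B : {set U}) (C : {set V}) :
  (forall a b c, a \in A -> b \in B -> c \in C -> a + mul b c \in S) ->
  (#|G| < 2 * #|S|)%N \/
  (#|A| * #|B| * #|C| * k <= 4 * (#|U| * #|V|) * #|S|)%N.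
Proof.
move=> AB_S; case: (ltnP #|G| (2 * #|S|)) => [|leSG]; [by left | right].
set P := (#|A| * #|B| * #|C|)%N.
pose M (i : Iirr [set: G]) := \sum_(b in B) \sum_(c in C) 'chi_i (mul b c).
have count : (#|G| * P)%:R = \sum_i fourier G A i * M i * (fourier G S i)^*.
  have E i : fourier G A i * M i * (fourier G S i)^* =
      \sum_(a in A) \sum_(b in B) \sum_(c in C) \sum_(s in S)
         'chi_i (a + mul b c) * ('chi_i s)^*.
    rewrite /fourier /M rmorph_sum -mulrA mulr_suml; apply: eq_bigr => a _.
    rewrite mulr_suml mulr_sumr; apply: eq_bigr => b _.
    rewrite mulr_suml mulr_sumr; apply: eq_bigr => c _.
    rewrite !mulr_sumr; apply: eq_bigr => s _.
    by rewrite (irr_additive_char G i).1 mulrA.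
  have -> : (#|G| * P)%:R =
      \sum_(a in A) \sum_(b in B) \sum_(c in C) (#|G|%:R : algC).
    by rewrite !sumr_const -!mulrnA; congr (_ *+ _); rewrite /P; ring.
  under [RHS]eq_bigr do rewrite E.
  rewrite [RHS]exchange_big; apply: eq_bigr => a aA /=.
  rewrite [RHS]exchange_big; apply: eq_bigr => b bB /=.
  rewrite [RHS]exchange_big; apply: eq_bigr => c cC /=.
  rewrite [RHS]exchange_big (bigD1 _ (AB_S a b c aA bB cC)) /= sum_irr_conj.
  rewrite eqxx big1 ?addr0 // => s /andP[_]; rewrite eq_sym sum_irr_conj.
  by move/negPf->.
have nontrivial_part : (P * (#|G| - #|S|))%:R =
    \sum_(i | i != 0) fourier G A i * M i * (fourier G S i)^*.
  have M0 : M 0 = (#|B| * #|C|)%:R.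
    rewrite /M natrM mulr_natl -sumr_const; apply: eq_bigr => b _.
    rewrite -sum1_card natr_sum; apply: eq_bigr => c _.
    by rewrite irr0 cfun1E inE.
  have leS : (#|S| <= #|G|)%N by rewrite max_card.
  rewrite mulnBr natrB ?leq_mul2l ?leS ?orbT // mulnC count (bigD1 0) //=.
  rewrite !fourier0 M0.
  by rewrite conjC_nat -!natrM (mulnA #|A|) -/P addrAC subrr add0r.
have M_le i : i != 0 ->
    `|M i| ^+ 2 * k%:R <= (#|B| * #|C| * (#|U| * #|V|))%:R.
  move=> i0; have chi_i := irr_additive_char G i.
  have := bilinear_char_sum_le U V G mul mulDl mulDr _ B C chi_i.
  move=> /(ler_wpM2r (ler0n _ k)) /le_trans; apply.
  rewrite -natrM ler_nat -!mulnA !leq_mul2l.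
  by rewrite (annihilator_le _ chi_i (irr_nontrivial G i i0)) !orbT.
have err : ((P * (#|G| - #|S|)) ^ 2 * k <=
    #|B| * #|C| * (#|U| * #|V|) * (#|G| * #|A|) * (#|G| * #|S|))%N.
  rewrite -(ler_nat algC) natrM natrX -[in leLHS](normr_nat algC).
  rewrite nontrivial_part.
  have := cauchy_schwarz_sum _ _ (fun i => i != 0)
    (fun i => fourier G A i * M i) (fun i => (fourier G S i)^*).
  move=> /(ler_wpM2r (ler0n _ k)) /le_trans; apply.
  rewrite mulrAC [leRHS]natrM; apply: ler_pM.
  - rewrite mulr_ge0 ?ler0n ?sumr_ge0 // => i _.
    by rewrite exprn_ge0 ?normr_ge0.
  - by rewrite sumr_ge0 // => i _; rewrite exprn_ge0 ?normr_ge0.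
  - rewrite [leRHS]natrM -parseval mulr_suml mulr_sumr [leRHS](bigD1 0) //=.
    apply: ler_wpDl; first by rewrite mulr_ge0 ?exprn_ge0 ?normr_ge0 ?ler0n.
    apply: ler_sum => i i0; rewrite normrM exprMn -mulrA mulrC.
    by apply: ler_wpM2r; rewrite ?exprn_ge0 ?normr_ge0 ?M_le.
  - rewrite -parseval [leRHS](bigD1 0) //= ler_wpDl ?exprn_ge0 ?normr_ge0 //.
    by apply: ler_sum => i _; rewrite norm_conjC.
have [P0|Pgt0] := posnP P; first by rewrite P0.
have Ggt0 : (0 < #|G|)%N by apply/card_gt0P; exists 0.
have PGgt0 : (0 < P * #|G| ^ 2)%N by rewrite muln_gt0 Pgt0 expn_gt0 Ggt0.
rewrite -(leq_pmul2l PGgt0).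
apply: (@leq_trans (4 * ((P * (#|G| - #|S|)) ^ 2 * k))).
  have : (#|G| ^ 2 <= 4 * (#|G| - #|S|) ^ 2)%N.
    by rewrite -[4%N]/(2 ^ 2)%N -expnMn leq_exp2r //; lia.
  move/(leq_mul (leqnn (P ^ 2 * k)%N)) => h; rewrite expnMn.
  by apply: leq_trans (leq_trans _ h) _; apply: eq_leq; rewrite -/P; ring.
apply: leq_trans (leq_mul (leqnn 4) err) _.
by apply: eq_leq; rewrite /P; ring.
Qed.

(** * Proper left ideals of a matrix ring over a local ring *)

Section LocalRing.
Variables (R : finComNzRingType) (m : idealr R).
Hypothesis local_m : local_ring m.

(** If x is not a unit, a maximal one among the proper ideals above xR exists,
    equals m by uniqueness, and so m contains x. *)
Lemma local_ring_unit (x : R) : x \notin m -> exists z, z * x = 1.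
Proof.
move=> xm; apply/'exists_eqP; apply: contraT.
rewrite negb_exists => /forallP nz.
(* The closure conditions are decidable since R is finite, so that a maximal
   such subset can be taken among the finite sets. *)
pose is_ideal (T : {set R}) :=
  [&& 0 \in T, 1 \notin T
    & [forall a, forall u in T, forall v in T, a * u + v \in T]].
have idealP (T : {set R}) : is_ideal T -> idealr_closed T.
  case/and3P=> T0 T1 /forallP Tc; split => // a u v uT vT.
  by have /forall_inP/(_ u uT)/forall_inP/(_ v vT) := Tc a.
pose xR := [set y | [exists z, y == z * x]].
have xR_ideal : is_ideal xR.
  apply/and3P; split.
  - by rewrite inE; apply/existsP; exists 0; rewrite mul0r.
  - by rewrite inE; apply/existsP => -[z]; rewrite eq_sym; exact/negP.
  apply/forallP => a; apply/forall_inP => u; rewrite inE => /existsP[y /eqP->].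
  apply/forall_inP => v; rewrite inE => /existsP[z /eqP->].
  by rewrite inE; apply/existsP; exists (a * y + z); rewrite mulrDl mulrA.
have [T /maxsetP[T_ideal T_max] xT] := maxset_exists xR_ideal.
pose T_isIdealr : isIdealr R (fun y => y \in T) :=
  isIdealr.Build R (fun y => y \in T) (idealP T T_ideal).
pose I : idealr R := HB.pack (fun y : R => y \in T) T_isIdealr.
have I_max : maximal_ideal I.
  move=> J sIJ y; have J_ideal : is_ideal [set y in J].
    apply/and3P; split; rewrite ?inE ?idealr0 ?idealr1 //.
    apply/forallP => a; apply/forall_inP => u; rewrite inE => uJ.
    apply/forall_inP => v; rewrite !inE => vJ.
    by rewrite rpredD // idealMr.
  have sTJ : T \subset [set y in J].
    by apply/subsetP => z zT; rewrite inE; apply: sIJ.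
  by have /setP/(_ y) := T_max _ J_ideal sTJ; rewrite inE.
have : x \in I.
  apply: (subsetP xT); rewrite inE.
  by apply/existsP; exists 1; rewrite mul1r.
by rewrite (local_m.2 I I_max) (negPf xm).
Qed.

(** Some matrix unit with its 1 in a column j is missing from J. Let E t have
    the entries t_i in column j and zeros elsewhere, for t in (R/m)^n with
    coordinates lifted to R. If E t - E t' lay in J for t <> t', a coordinate
    of the difference would be invertible, and left multiplication would turn
    this row into the missing matrix unit. So J has at least q^n distinct
    cosets. *)
Lemma card_proper_left_ideal_le n (J : {set 'M[R]_n}) :
  0 \in J -> {in J &, forall u v, u - v \in J} ->
  (forall w v, v \in J -> w *m v \in J) -> (exists x, x \notin J) ->
  (#|J| * #|{: residue_ring m}| ^ n <= #|{: 'M[R]_n}|)%N.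
Proof.
move=> J0 JB JM [x xJ].
have JD : {in J &, forall u v, u + v \in J}.
  by move=> u v uJ vJ; rewrite -[v]opprK JB // -sub0r JB.
have /existsP[j /existsP[k ekj]] : [exists j, exists k, delta_mx k j \notin J].
  apply: contraR xJ; rewrite negb_exists => /forallP eJ.
  rewrite [x]matrix_sum_delta.
  apply: (big_ind (fun y => y \in J)) => // k _.
  apply: (big_ind (fun y => y \in J)) => // j _.
  have := eJ j; rewrite negb_exists => /forallP/(_ k)/negPn ekj.
  by rewrite -mul_scalar_mx JM.
pose E (t : {ffun 'I_n -> residue_ring m}) : 'M[R]_n :=
  \matrix_(i, l) (generic_quotient.repr (t i : {ideal_quot m}) *+ (l == j)).
pose f (p : {ffun 'I_n -> residue_ring m} * 'M[R]_n) := p.2 + E p.1.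
have f_inj : {in setX setT J &, injective f}.
  move=> [t D] [t' D']; rewrite !inE /f /= => DJ D'J eq_f.
  have dE : E t - E t' \in J.
    have -> : E t - E t' = D' - D.
      by apply: (addrI D); rewrite addrA eq_f addrK addrC subrK.
    exact: JB.
  have tE : t = t'.
    apply/ffunP => i.
    rewrite -[t i](@reprK _ {ideal_quot m}) -[t' i](@reprK _ {ideal_quot m}).
    apply/eqP; rewrite -Quotient.idealrBE.
    apply: contraR ekj => /local_ring_unit[z zE].
    have -> : delta_mx k j = (z *: delta_mx k i) *m (E t - E t').
      apply/matrixP => a b.
      rewrite -scalemxAl !mxE (bigD1 i) //= !mxE eqxx andbT.
      rewrite big1 ?addr0 => [|l /negPf li]; last first.
        by rewrite !mxE li andbF mul0r.
      case: (a == k); rewrite ?mul0r ?mulr0 // mul1r.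
      by case: (b == j); rewrite ?mulr1n ?mulr0n ?subrr ?mulr0.
    exact: JM.
  by move: eq_f; rewrite tE => /addIr->.
rewrite mulnC -[X in (_ ^ X)%N]card_ord -card_ffun -cardsT -cardsX.
by rewrite -(card_in_imset f_inj) max_card.
Qed.

(** * The growth of A + BC *)

(** The annihilator of a nontrivial character is a left ideal, and it is proper
    because it contains 1 only if the character is trivial. *)
Lemma card_addmul_set n (A B C : {set 'M[R]_n}) :
  (#|{: 'M[R]_n}| < 2 * #|addmul_set A B C|)%N \/
  (#|A| * #|B| * #|C| * #|{: residue_ring m}| ^ n
    <= 4 * #|{: 'M[R]_n}| ^ 2 * #|addmul_set A B C|)%N.
Proof.
rewrite -mulnn; apply: (add_mul_expansion _ _ _ (@mulmx R n n n)).
- by move=> v x y; apply: mulmxDl.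
- by move=> u x y; apply: mulmxDr.
- move=> phi phi_char [x phix]; apply: card_proper_left_ideal_le.
  + rewrite inE; apply/forallP => u.
    by rewrite mulmx0 (additive_char0 _ _ phi_char).
  + move=> v w; rewrite !inE => /forallP v1 /forallP w1; apply/forallP => u.
    have := v1 u; rewrite -[v in u *m v](subrK w) mulmxDr phi_char.1.
    by rewrite (eqP (w1 u)) mulr1.
  + move=> w v; rewrite !inE => /forallP v1; apply/forallP => u.
    by rewrite mulmxA.
  + exists x; rewrite inE negb_forall; apply/existsP; exists 1%:M.
    by rewrite mul1mx.
- by move=> a b c aA bB cC; apply: imset2_f => //; exact: imset2_f.
Qed.

End LocalRing.

Theorem theorem1p12 (K : realType) (n : nat) (hn : (0 < n)%N) :
  exists c : K, 0 < c /\
    forall (R : finComNzRingType) (m : idealr R) (q r : nat)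
      (hR : finite_chain_ring m)
      (hq : #|{: residue_ring m}| = q)
      (hr : #|{: R}| = (q ^ r)%N)
      (A B C : {set 'M[R]_n}),
      c * Num.min (q%:R ^+ (r * n ^ 2))
            ((#|A| * #|B| * #|C|)%:R /
               q%:R `^ ((2 * r * n ^ 2)%:R - n.+1%:R / 2))
        <= #|addmul_set A B C|%:R.
Proof.
exists (1 / 4); split; first by lra.
move=> R m q r hR hq hr A B C.
have q0 : (0 < q)%N by rewrite -hq; apply/card_gt0P; exists 0.
have cardM : #|{: 'M[R]_n}| = (q ^ (r * n ^ 2))%N.
  by rewrite card_mx hr -expnM mulnn.
set P := (#|A| * #|B| * #|C|)%N; set s := #|addmul_set A B C|.
set X := _ `^ _.
have := card_addmul_set R m hR.1 n A B C.
rewrite -/P -/s hq cardM => -[lt_s|le_s].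
  apply: (@le_trans _ _ (1 / 4 * q%:R ^+ (r * n ^ 2))).
    by rewrite ler_wpM2l ?ge_min ?lexx //; lra.
  rewrite -natrX; move: lt_s => /ltnW; rewrite -(ler_nat K) natrM.
  have : 0 <= (s%:R : K) by [].
  lra.
have qK : 0 < (q%:R : K) by rewrite ltr0n.
have X0 : 0 < X by rewrite powR_gt0.
(* The exponent on the right is 2rn^2 + (n - 1)/2. *)
have leX : q%:R ^+ (r * n ^ 2) ^+ 2 <= X * q%:R ^+ n.
  rewrite -exprM -!powR_mulrn ?ler0n // -powRD; last first.
    by apply/implyP => _; rewrite gt_eqF.
  apply: ler_powR; first by rewrite ler1n.
  rewrite (_ : (r * n ^ 2 * 2 = 2 * r * n ^ 2)%N); last by ring.
  have : (1 : K) <= n%:R by rewrite ler1n.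
  rewrite -[n.+1]addn1 natrD; lra.
apply: (@le_trans _ _ (1 / 4 * (P%:R / X))).
  by rewrite ler_wpM2l ?ge_min ?lexx ?orbT //; lra.
suff : P%:R / X <= 4 * s%:R by lra.
rewrite ler_pdivrMr // -(ler_pM2r (exprn_gt0 n qK)).
move: le_s; rewrite -(ler_nat K) !natrM !natrX => /le_trans; apply.
have -> : 4 * s%:R * X * q%:R ^+ n = 4 * (X * q%:R ^+ n) * s%:R by ring.
by rewrite ler_wpM2r ?ler0n // ler_wpM2l ?ler0n.
Qed.
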